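(* Let $k\geq 1$ and let $L=\{U_1,\ldots,U_k\}$ be the first-order language with $k$ unary predicate symbols. Then every basic property of $L$ is regular; that is, for every $1\leq p\leq k$, every $\bar{s}=\langle i_1,\ldots,i_p\rangle$ with $1\leq i_1<\cdots<i_p\leq k$, and every $e\in\{0,1\}^k$, the property $\phi_{\bar{s},e}(x)=U_{i_1}^{e(i_1)}(x)\wedge\cdots\wedge U_{i_p}^{e(i_p)}(x)$ is regular. In particular every property $\phi_e(x)=U_1^{e(1)}(x)\wedge\cdots\wedge U_k^{e(k)}(x)$, $e\in\{0,1\}^k$, as well as every $U_i(x)$ and $\neg U_i(x)$, for $i=1,\ldots,k$, is regular.
   Context: For a predicate symbol $U_i$ put $U_i^{1}(x)=U_i(x)$ and $U_i^{0}(x)=\neg U_i(x)$. For a language $L$ let $\mathbf{S}_n(L)$ be the set of $L$-structures with universe $\{1,\ldots,n\}$. For a formula $\phi(x)$ of $L$ with one free variable and without parameters (a ''property''), and an $L$-structure $\mathcal{M}$ with universe $M$, let $\phi(\mathcal{M})=\{a\in M:\mathcal{M}\models\phi(a)\}$. Let $\mathbf{S}_{2n}(\phi:\mathrm{ntr})=\{\mathcal{M}\in\mathbf{S}_{2n}(L):|\phi(\mathcal{M})|=n\}$ (the structures of size $2n$ for which $\phi$ is neutral), $d_{2n}(\phi:\mathrm{ntr})=|\mathbf{S}_{2n}(\phi:\mathrm{ntr})|/|\mathbf{S}_{2n}(L)|$, and $d(\phi:\mathrm{ntr})=\lim_{n\to\infty}d_{2n}(\phi:\mathrm{ntr})$ whenever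 this limit exists. The property $\phi(x)$ is regular if $d(\phi:\mathrm{ntr})=0$. *)

(* Defs.v *)
From HB Require Import structures.
From mathcomp Require Import all_boot all_order all_algebra.
From mathcomp Require Import all_classical all_reals topology normedtype sequences.

Set Implicit Arguments.
Unset Strict Implicit.
Unset Printing Implicit Defensive.

Import Order.TTheory GRing.Theory Num.Theory.
Import numFieldNormedType.Exports.

Local Open Scope classical_set_scope.
Local Open Scope ring_scope.

(* Finite relational first-order languages. *)
Record language := Language {
  relsym :> finType;
  arity : relsym -> nat
}.

(* [formula L m]: formulas of L whose free variables are among x_0, ..., x_(m-1).
   Variables are de Bruijn indices: under a quantifier, index 0 is the newly
   bound variable and the others are shifted by one. *)
Inductive formula (L : language) : nat -> Type :=
| FTrue m : formula L m
| FEq m (i j : 'I_m) : formula L m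
| FRel m (r : L) (a : (arity r).-tuple 'I_m) : formula L m
| FNot m (phi : formula L m) : formula L m
| FAnd m (phi psi : formula L m) : formula L m
| FOr m (phi psi : formula L m) : formula L m
| FImp m (phi psi : formula L m) : formula L m
| FAll m (phi : formula L m.+1) : formula L m
| FEx m (phi : formula L m.+1) : formula L m.

Arguments FTrue {L m}.
Arguments FEq {L m}.
Arguments FRel {L m}.

Definition property (L : language) : Type := formula L 1.

(* The finite type S_n(L); the universe {1, ..., n} is encoded as 'I_n. *)
Definition structures (L : language) (n : nat) : finType :=
  {dffun forall r : L, {set (arity r).-tuple 'I_n}}.

Definition interp (L : language) (n : nat) (M : structures L n) (r : L) :
  {set (arity r).-tuple 'I_n} := (M : {dffun forall r : L, _}) r.

Definition env_cons (T : Type) (m : nat) (a : T) (v : 'I_m -> T) :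
  'I_m.+1 -> T := fun i => if unlift ord0 i is Some j then v j else a.

Fixpoint sat (L : language) (n : nat) (M : structures L n) (m : nat)
    (phi : formula L m) : ('I_m -> 'I_n) -> bool :=
  match phi in formula _ m return ('I_m -> 'I_n) -> bool with
  | FTrue _ => fun _ => true
  | FEq _ i j => fun v => v i == v j
  | FRel _ r a => fun v => map_tuple v a \in interp M r
  | FNot _ phi => fun v => ~~ sat M phi v
  | FAnd _ phi psi => fun v => sat M phi v && sat M psi v
  | FOr _ phi psi => fun v => sat M phi v || sat M psi v
  | FImp _ phi psi => fun v => sat M phi v ==> sat M psi v
  | FAll _ phi => fun v => [forall a, sat M phi (env_cons a v)]
  | FEx _ phi => fun v => [exists a, sat M phi (env_cons a v)]
  end.

(* phi(M) *)
Definition extension (L : language) (n : nat) (phi : property L)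
  (M : structures L n) : {set 'I_n} := [set a | sat M phi (fun=> a)].

(* S_{2n}(phi : ntr) *)
Definition neutral_structures (L : language) (phi : property L) (n : nat) :
  {set structures L (2 * n)} := [set M | #|extension phi M| == n].

(* d_{2n}(phi : ntr) *)
Definition neutral_ratio (R : realType) (L : language) (phi : property L)
  (n : nat) : R :=
  #|neutral_structures phi n|%:R / #|structures L (2 * n)|%:R.

(* d(phi : ntr) exists and equals l *)
Definition has_neutral_density (R : realType) (L : language)
  (phi : property L) (l : R) : Prop :=
  neutral_ratio R phi n @[n --> \oo] --> l.

Definition regular (R : realType) (L : language) (phi : property L) : Prop :=
  has_neutral_density phi (0 : R).

(* The symbols U_1, ..., U_k are indexed by 'I_k, i.e. shifted to 0, ..., k-1. *)
Definition unary_language (k : nat) : language :=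
  @Language 'I_k (fun=> 1).

Definition U (k : nat) (i : 'I_k) : property (unary_language k) :=
  @FRel (unary_language k) 1 i [tuple ord0].

(* U_i^b, with true for 1 and false for 0 *)
Definition literal (k : nat) (i : 'I_k) (b : bool) :
  property (unary_language k) := if b then U i else FNot (U i).

(* A one-term conjunction is the term itself; FTrue arises only from the
   empty sequence. *)
Fixpoint conjunction (L : language) (m : nat) (s : seq (formula L m)) :
  formula L m :=
  match s with
  | [::] => FTrue
  | [:: phi] => phi
  | phi :: s' => FAnd phi (conjunction s')
  end.

(* phi_{s,e} *)
Definition basic_property (k : nat) (s : seq 'I_k) (e : {ffun 'I_k -> bool}) :
  property (unary_language k) :=
  conjunction [seq literal i (e i) | i <- s].

(* phi_e *)
Definition full_basic_property (k : nat) (e : {ffun 'I_k -> bool}) :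
  property (unary_language k) := basic_property (enum 'I_k) e.

(* Main.v *)
(* A structure for k unary predicates on a set of size 2n is a function from
   that set to the 2^k atomic types, and a basic property holds of a point iff
   its atomic type lies in a fixed set P of types. With q = |P| and
   r = 2^k - q there are C(2n, n) q^n r^n neutral structures out of
   (q + r)^(2n). Since 4 q r <= (q + r)^2, the neutral ratio is at most
   C(2n, n) / 4^n, which is at most 1 / sqrt(2n + 1). *)

Require Import Defs.
From mathcomp Require Import all_boot all_order all_algebra.
From mathcomp Require Import all_classical all_reals.
From mathcomp Require Import zify.
From mathcomp Require Import interval_inference topology normedtype sequences.

Set Implicit Arguments.
Unset Strict Implicit.
Unset Printing Implicit Defensive.

Import Order.TTheory GRing.Theory Num.Theory.
Import numFieldNormedType.Exports.

Local Open Scope nat_scope.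

(** The values of [f] are chosen independently: inside [P] at the points of [A], outside [P]
    elsewhere. So these functions form a dependent product [family F]. *)
Lemma card_ffun_preim_eq (D T : finType) (P : pred T) (A : {set D}) :
  #|[set f : {ffun D -> T} | [set a | P (f a)] == A]| =
  #|P| ^ #|A| * #|[predC P]| ^ (#|D| - #|A|).
Proof.
pose F (a : D) : pred T := if a \in A then P else [predC P].
have -> : #|[set f : {ffun D -> T} | [set a | P (f a)] == A]| = #|family F|.
  apply: eq_card => f; rewrite inE; apply/eqP/familyP => [defA a | famf].
    by rewrite /F -defA inE; case: ifP => // /negbT.
  apply/setP => a; rewrite inE; have := famf a; rewrite /F.
  by case: ifP => _ => [| /negbTE] Pfa; exact: Pfa.
rewrite card_family foldrE big_image/= (bigID (mem A))/=; congr (_ * _).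
  rewrite -prod_nat_const; apply: eq_bigr => a aA.
  by rewrite /F aA.
have -> : #|D| - #|A| = #|~: A| by rewrite -(cardsC A) addKn.
rewrite -prod_nat_const; apply: eq_big => [a | a /negbTE aA].
  by rewrite inE.
by rewrite /F aA.
Qed.

(** Sort the functions by the preimage of [P]; every [n]-subset of [D] contributes the same
    number. *)
Lemma card_ffun_card_preim (D T : finType) (P : pred T) (n : nat) :
  #|[set f : {ffun D -> T} | #|[set a | P (f a)]| == n]| =
  'C(#|D|, n) * (#|P| ^ n * #|[predC P]| ^ (#|D| - n)).
Proof.
rewrite -sum1dep_card (partition_big (fun f : {ffun D -> T} =>
  [set a | P (f a)]) (fun A : {set D} => #|A| == n)) //=.
rewrite -card_draws -sum_nat_const big_mkcond [RHS]big_mkcond/=.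
apply: eq_bigr => A _; rewrite !inE; case: eqP => // cardA.
rewrite -cardA -card_ffun_preim_eq -sum1dep_card; apply: eq_bigl => f.
by case: (_ =P A) => [->|_]; rewrite ?eqxx ?andbF.
Qed.

Lemma leq_central_bin_sqr (n : nat) : n.+1 * 'C(2 * n, n) ^ 2 <= 16 ^ n.
Proof.
(* The induction goes through with the sharper factor 2n + 1. *)
suff: n.*2.+1 * 'C(2 * n, n) ^ 2 <= 16 ^ n.
  by apply: leq_trans; rewrite leq_mul2r ltnS -addnn leq_addr orbT.
elim: n => [|n IHn]; first by rewrite muln0 bin0.
have rec : n.+1 * 'C(2 * n.+1, n.+1) = (n.*2.+1).*2 * 'C(2 * n, n).
  apply/eqP; rewrite -(eqn_pmul2l (ltn0Sn n)); apply/eqP.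
  rewrite -(mul_bin_diag (2 * n.+1) n).
  have -> : (2 * n.+1).-1 = (2 * n).+1 by rewrite mulnS.
  have := mul_bin_down (2 * n).+1 n; rewrite /= => e.
  have d : (2 * n).+1 - n = n.+1 by rewrite mul2n -addnn -addSn addnK.
  rewrite d in e; rewrite mulnCA -e; nia.
have pos : 0 < n.+1 ^ 2 by rewrite expn_gt0.
rewrite -(leq_pmul2l pos) mulnCA -expnMn rec expnMn.
(* Up to common factors, the first inequality of this chain is (2n+1)(2n+3) <= 4(n+1)^2. *)
apply: (@leq_trans (n.+1 ^ 2 * (16 * (n.*2.+1 * 'C(2 * n, n) ^ 2)))); last first.
  by rewrite [16 ^ _]expnS leq_pmul2l // leq_pmul2l.
rewrite !mulnA leq_mul2r; apply/orP; right.
rewrite -!mul2n; nia.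
Qed.

Lemma card_structures_unary (k n : nat) :
  #|structures (unary_language k) n| = #|{ffun 'I_k -> bool}| ^ n.
Proof.
have card_rel m : #|{set m.-tuple 'I_n}| = 2 ^ (n ^ m).
  by rewrite -cardsT -powersetT card_powerset cardsT card_tuple card_ord.
(* The arity in [unary_language] is parsed in ring scope, as the unit of the semiring [nat]; it is
   converted to the numeral 1. *)
rewrite card_dep_ffun foldrE big_image /= card_rel prod_nat_const -[1%R]/1.
by rewrite card_ffun card_bool !card_ord expn1 -!expnM mulnC.
Qed.

Definition atomic_type (k n : nat) (M : structures (unary_language k) n)
  (a : 'I_n) : {ffun 'I_k -> bool} := [ffun i => [tuple a] \in interp M i].

(** Every relation is unary, so the types of the points determine the structure. Injectivity is
    enough to bound the number of neutral structures from above. *)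
Lemma atomic_type_inj (k n : nat) :
  injective (fun M : structures (unary_language k) n =>
    finfun (atomic_type M)).
Proof.
move=> M M' /ffunP eqM; apply/ffunP => i; apply/setP => t.
have := eqM (tnth t ord0); rewrite !ffunE => /ffunP /(_ i); rewrite !ffunE.
suff -> : [tuple tnth t ord0] = t by [].
by apply: eq_from_tnth => j; rewrite (ord1 (j : 'I_1)).
Qed.

Lemma card_neutral_structures_le (k n : nat) (phi : property (unary_language k))
    (P : pred {ffun 'I_k -> bool}) :
  (forall m (M : structures (unary_language k) m) (a : 'I_m),
     sat M phi (fun=> a) = P (atomic_type M a)) ->
  #|neutral_structures phi n| * 4 ^ n <=
  'C(2 * n, n) * #|structures (unary_language k) (2 * n)|.
Proof.
move=> phiP.
pose T := {ffun 'I_k -> bool}; pose D := 'I_(2 * n).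
pose N := [set f : {ffun D -> T} | #|[set a | P (f a)]| == n].
have leN : #|neutral_structures phi n| <= #|N|.
  rewrite -(card_imset _ (@atomic_type_inj k (2 * n))).
  apply/subset_leq_card/fintype.subsetP => _ /imsetP[M + ->]; rewrite !inE.
  by congr (_ == _); apply: eq_card => a; rewrite !inE phiP ffunE.
apply: (leq_trans (leq_mul leN (leqnn _))).
rewrite card_ffun_card_preim card_structures_unary card_ord.
rewrite -mulnA leq_mul2l; apply/orP; right.
have -> : 2 * n - n = n by rewrite mul2n -addnn addnK.
(* Both sides are now [n]-th powers; for positive [n] the bases are compared by 4qr <= (q+r)^2. *)
rewrite -!expnMn expnM; case: (posnP n) => [-> // | n_gt0].
rewrite leq_exp2r // mulnC -(cardC P).
exact: nat_AGM2.
Qed.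

Local Open Scope ring_scope.
Local Open Scope classical_set_scope.

Lemma central_bin_ratio_cvg0 (R : realType) :
  ('C(2 * n, n)%:R / 4 ^+ n : R) @[n --> \oo] --> (0 : R).
Proof.
apply/cvgr0Pnorm_lt => e e0.
have e20 : 0 < e ^+ 2 by rewrite exprn_gt0.
near=> n; rewrite ger0_norm ?divr_ge0 ?exprn_ge0//.
(* Squaring avoids the square root: the squared ratio is at most 1/(n+1), which is eventually below
   [e ^+ 2]. *)
rewrite -(@ltr_pXn2r _ 2) ?nnegrE ?divr_ge0 ?exprn_ge0 ?(ltW e0)//.
apply: (@le_lt_trans _ _ (n.+1%:R^-1)); last first.
  by near: n; exact: (near_infty_natSinv_lt (PosNum e20)).
rewrite expr_div_n -!natrX ler_pdivrMr ?ltr0n ?expn_gt0//.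
rewrite mulrC ler_pdivlMr ?ltr0n// -natrM ler_nat mulnC -expnM.
rewrite [(n * 2)%N]mulnC expnM.
exact: leq_central_bin_sqr.
Unshelve. all: by end_near. Qed.

Lemma regular_atomic_type (R : realType) (k : nat)
    (phi : property (unary_language k)) (P : pred {ffun 'I_k -> bool}) :
  (forall m (M : structures (unary_language k) m) (a : 'I_m),
     sat M phi (fun=> a) = P (atomic_type M a)) ->
  regular R phi.
Proof.
move=> phiP; rewrite /regular /has_neutral_density.
apply: (@squeeze_cvgr _ _ _ _ (fun=> 0)
  (fun n => 'C(2 * n, n)%:R / 4 ^+ n)); last 2 first.
- exact: cvg_cst.
- exact: central_bin_ratio_cvg0.
near=> n; rewrite divr_ge0//= /neutral_ratio.
rewrite ler_pdivrMr; last first.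
  by rewrite ltr0n card_structures_unary card_ffun card_bool -expnM expn_gt0.
rewrite mulrAC ler_pdivlMr ?exprn_gt0// -natrX -!natrM ler_nat.
exact: card_neutral_structures_le phiP.
Unshelve. all: by end_near. Qed.

Lemma sat_conjunction (L : language) (n m : nat) (M : structures L n)
    (s : seq (formula L m)) (v : 'I_m -> 'I_n) :
  sat M (conjunction s) v = all (fun phi => sat M phi v) s.
Proof.
(* The tail is split too, because a one-term conjunction has no trailing [FTrue]. *)
elim: s => [//|phi [|psi s] IHs]; first by rewrite /= andbT.
by rewrite -[LHS]/(sat M phi v && sat M (conjunction (psi :: s)) v) IHs.
Qed.

Lemma sat_U (k n : nat) (M : structures (unary_language k) n) (i : 'I_k)
    (a : 'I_n) : sat M (U i) (fun=> a) = atomic_type M a i.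
Proof.
rewrite ffunE -[LHS]/(map_tuple (fun=> a) [tuple ord0] \in interp M i).
by congr (fun t : 1.-tuple 'I_n => t \in interp M i); apply: val_inj.
Qed.

Lemma regular_basic_property (R : realType) (k : nat) (s : seq 'I_k)
    (e : {ffun 'I_k -> bool}) : regular R (basic_property s e).
Proof.
apply: (@regular_atomic_type _ _ _
  (fun t => all (fun i => t i == e i) s)) => n M a.
rewrite sat_conjunction all_map; apply: eq_all => i /=.
rewrite /literal; case: (e i); first by rewrite sat_U; case: (_ i).
by rewrite -[LHS]/(~~ sat M (U i) (fun=> a)) sat_U; case: (_ i).
Qed.

Theorem theorem3p7 (R : realType) (k : nat) (hk : (1 <= k)%N) :
  [/\ (forall (p : nat) (s : p.-tuple 'I_k) (e : {ffun 'I_k -> bool}),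
         (1 <= p <= k)%N ->
         sorted (fun i j : 'I_k => (i < j)%N) s ->
         regular R (basic_property s e)),
      (forall e : {ffun 'I_k -> bool}, regular R (full_basic_property e)),
      (forall i : 'I_k, regular R (U i))
    & (forall i : 'I_k, regular R (FNot (U i)))].
Proof.
split=> [p s e _ _|e|i|i].
- exact: regular_basic_property.
- exact: regular_basic_property.
(* A single literal is the basic property on [[:: i]]; the constant sign function selects [U i] here
   and its negation below. *)
- by have := @regular_basic_property R k [:: i] [ffun=> true];
     rewrite /basic_property/= /literal ffunE.
- by have := @regular_basic_property R k [:: i] [ffun=> false];
     rewrite /basic_property/= /literal ffunE.
Qed.
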